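(* For every $n\ge2$, \[ \mathrm{FC}(B_n)=\biguplus_{\pi\in \mathrm{FC}(S_n)} B_n(\pi)\cdot\pi , \] a disjoint union, where $B_n(\pi)\cdot\pi=\{\mu\pi\mid \mu\in B_n(\pi)\}$ and \[ B_n(\pi):=\begin{cases}\{\mu_1\mu_2\cdots\mu_{v(\pi)} \mid \mu_i\in\{e,\delta_i\}\ \text{for each } i\} & \text{if } 1\notin \mathrm{Des}(\pi^{-1}),\\ \{e,\delta_1,\delta_2,\ldots,\delta_{v(\pi)}\} & \text{if } 1\in\mathrm{Des}(\pi^{-1}).\end{cases} \]
   Context: $B_n$ is the group of signed permutations of $\{\pm1,\ldots,\pm n\}$, composed as functions ($(uv)(i)=u(v(i))$), with Coxeter generators $s_0=[-1,2,\ldots,n]$ and $s_i=[1,\ldots,i-1,i+1,i,i+2,\ldots,n]$ ($1\le i\le n-1$); $e$ is the identity. An element is fully commutative (FC) if any reduced expression can be obtained from any other using only commutation relations between commuting generators. $\mathrm{FC}(B_n)$ is the set of FC elements of $B_n$; $\mathrm{FC}(S_n)=\mathrm{FC}(B_n)\cap S_n$ (the $321$-avoiding permutations of $[n]$). For $\sigma\in S_n$, $\mathrm{Des}(\sigma)=\{1\le i\le n-1\mid \sigma_i>\sigma_{i+1}\}$. For $1\le i\le n$, $\delta_i:=s_{i-1}s_{i-2}\cdots s_1s_0$ (so $\delta_1=s_0$). The first valley of $\pi\in\mathrm{FC}(S_n)$ is $v(\pi):=\min(\mathrm{Des}(\pi^{-1})\setminus\{1\})$ if $\mathrm{Des}(\pi^{-1})\setminus\{1\}\neq\emptyset$,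 and $v(\pi):=n$ otherwise. *)

(* Defs.v *)
From mathcomp Require Import all_boot all_order all_fingroup.
From Stdlib Require Import Relations.
Set Implicit Arguments. Unset Strict Implicit. Unset Printing Implicit Defensive.

(* Signed permutations of {+-1,...,+-n}: the point (false, i) encodes the
   value i+1 and (true, i) encodes -(i+1), for i : 'I_n. *)
Definition pt (n : nat) := (bool * 'I_n)%type.

Definition negp n (x : pt n) : pt n := (~~ x.1, x.2).

Definition Bn (n : nat) : {set {perm pt n}} :=
  [set w : {perm pt n} | [forall x, w (negp x) == negp (w x)]].

(* composition as functions: (bcomp u v) x = u (v x)  (mathcomp's u*v is v o u) *)
Definition bcomp n (u v : {perm pt n}) : {perm pt n} := (v * u)%g.

Definition pred_ord n (i : 'I_n) : 'I_n :=
  Ordinal (leq_ltn_trans (leq_pred i) (ltn_ord i)).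

Definition gen n (i : 'I_n) : {perm pt n} :=
  if val i == 0 then tperm (false, i) (true, i)
  else (tperm (false, pred_ord i) (false, i) * tperm (true, pred_ord i) (true, i))%g.

Definition wordProd n (a : seq 'I_n) : {perm pt n} :=
  foldr (fun i acc => bcomp (gen i) acc) 1%g a.

Definition reducedWord n (w : {perm pt n}) (a : seq 'I_n) : Prop :=
  wordProd a = w /\ forall b, wordProd b = w -> size a <= size b.

Definition commStep n (a b : seq 'I_n) : Prop :=
  exists (p q : seq 'I_n) (i j : 'I_n),
    i != j /\ bcomp (gen i) (gen j) = bcomp (gen j) (gen i) /\
    a = p ++ i :: j :: q /\ b = p ++ j :: i :: q.

Definition FC n (w : {perm pt n}) : Prop :=
  forall a b, reducedWord w a -> reducedWord w b -> clos_refl_trans _ (@commStep n) a b.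

Definition inSn n (w : {perm pt n}) : Prop :=
  w \in Bn n /\ forall x, (w x).1 = x.1.

Definition FC_Sn n (p : {perm pt n}) : Prop := inSn p /\ FC p.

(* 0-based value of pi^{-1}(k+1) *)
Definition invVal n (p : {perm pt n}) (k : nat) : nat :=
  if (insub k : option 'I_n) is Some i then val ((p^-1)%g (false, i)).2 else 0.

(* i \in Des(pi^{-1}), i 1-based in [1, n-1] *)
Definition desInv n (p : {perm pt n}) (i : nat) : bool :=
  (1 <= i <= n - 1) && (invVal p i < invVal p (i - 1)).

Definition valley n (p : {perm pt n}) : nat :=
  head n [seq i <- iota 2 (n - 2) | desInv p i].

Definition genN n (k : nat) : {perm pt n} :=
  if (insub k : option 'I_n) is Some i then gen i else 1%g.

Definition delta n (i : nat) : {perm pt n} :=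
  foldr (fun k acc => bcomp (genN n k) acc) 1%g (rev (iota 0 i)).

Definition Bpi n (p : {perm pt n}) (mu : {perm pt n}) : Prop :=
  if ~~ desInv p 1 then
    exists bs : seq bool, size bs = valley p /\
      mu = foldr (fun ib acc => bcomp (if ib.2 then delta n ib.1 else 1%g) acc) 1%g
             (zip (iota 1 (valley p)) bs)
  else mu = 1%g \/ exists i, 1 <= i <= valley p /\ mu = delta n i.

(* Main.v *)
Require Import Defs.
From mathcomp Require Import all_boot all_order all_fingroup.
From Stdlib Require Import Relations.
From mathcomp Require Import all_algebra zify.
Set Implicit Arguments. Unset Strict Implicit. Unset Printing Implicit Defensive.

(** Left multiplication of w by s_i acts on the window u = (w^-1(1), ..., w^-1(n))
    by exchanging entries i and i+1 (or by negating the first entry), and it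
    shortens w exactly when i is a descent of u.  Full commutativity is
    characterised by pattern avoidance in u ([fc_window]): the forbidden patterns
    cannot be created by removing a descent, and a window containing one either
    has two adjacent, hence noncommuting, descents, or a descent whose removal
    keeps a forbidden pattern.

    Every w factors as mu p, with mu a product of the delta_i and p a
    permutation.  Products of the delta_i are exactly the elements with
    increasing window, so p is the standardisation of w, which gives
    uniqueness.  The constraints defining B_n(p) are then what the forbidden
    patterns of u impose on the set of negative values of mu. *)

(** * Signed permutations and their integer windows *)

Definition vl n (x : pt n) : int :=
  if x.1 then (- x.2.+1%:Z)%R else x.2.+1%:Z%R.

Definition win n (w : {perm pt n}) (k : nat) : int :=
  if (insub k : option 'I_n) is Some i then vl (w (false, i)) else 0%R.

Lemma vl_inj n : injective (@vl n).
Proof.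
move=> [b i] [c j]; rewrite /vl /= => h.
have e : i = j by apply: val_inj => /=; move: h; case: b; case: c; lia.
by rewrite e; congr (_, _); move: h; case: b; case: c => //; lia.
Qed.

Lemma vl_negp n (x : pt n) : vl (negp x) = (- vl x)%R.
Proof. by case: x => [[] i]; rewrite /vl /= ?GRing.opprK. Qed.

Lemma BnP n (w : {perm pt n}) :
  reflect (forall x, w (negp x) = negp (w x)) (w \in Bn n).
Proof.
rewrite inE; apply: (iffP forallP) => h x; first exact/eqP.
by rewrite h.
Qed.

Lemma vl_range n (x : pt n) : (0 < vl x <= n%:Z)%R \/ (- n%:Z <= vl x < 0)%R.
Proof. by case: x => [[] i]; have := ltn_ord i; rewrite /vl /=; lia. Qed.

Lemma winE n (w : {perm pt n}) (i : 'I_n) : win w i = vl (w (false, i)).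
Proof. by rewrite /win valK. Qed.

(** The action of s_i transported along [vl], so that identities between generators become linear
    arithmetic on integers. *)
Definition gen_int (i : nat) (z : int) : int :=
  (if i is 0%N then (if `|z|%N == 1%N then - z else z)
  else if z == i%:Z then i.+1%:Z else if z == i.+1%:Z then i%:Z
  else if z == - i%:Z then - i.+1%:Z
  else if z == - i.+1%:Z then - i%:Z else z)%R.

Lemma genE n (i : 'I_n) b (j : 'I_n) : gen i (b, j) =
  if val i == 0 then if j == i then (~~ b, j) else (b, j)
  else if j == i then (b, pred_ord i)
  else if j == pred_ord i then (b, i) else (b, j).
Proof.
rewrite /gen; case: eqP => [i0|/eqP i0].
  by rewrite permE /= !xpair_eqE /=; case: b => /=; case: eqP => [->|].
have nip : i == pred_ord i = false by apply/negP => /eqP /(congr1 val) /=; move: i0 => /=; lia.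
have nip' : pred_ord i == i = false by rewrite eq_sym.
rewrite permM !permE /= !xpair_eqE /=.
by case: b => /=; case: (eqVneq j i) => [->|ji]; rewrite ?nip ?nip' /= ?xpair_eqE ?eqxx ?nip //=;
  case: (j == pred_ord i); rewrite /= ?xpair_eqE ?eqxx /= ?nip ?(negPf ji).
Qed.

Lemma vl_gen n (i : 'I_n) (x : pt n) : vl (gen i x) = gen_int i (vl x).
Proof.
case: x i => b [j hj] [i hi]; rewrite genE /gen_int /vl -!(inj_eq val_inj) /=.
by case: i hi => [|i] hi; case: b => /=; repeat (case: ifP => /=); lia.
Qed.

Lemma gen_intK i : involutive (gen_int i).
Proof. by move=> z; rewrite /gen_int; case: i => [|i]; repeat case: ifP; lia. Qed.

Lemma gen_intN i z : (gen_int i (- z) = - gen_int i z)%R.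
Proof. by rewrite /gen_int; case: i => [|i]; repeat case: ifP; lia. Qed.

Lemma gen_intC i j z : i.+1 < j -> gen_int i (gen_int j z) = gen_int j (gen_int i z).
Proof.
by case: i j => [|i] [|j] // ij; rewrite /gen_int; repeat case: ifP; lia.
Qed.

Lemma genK n (i : 'I_n) : involutive (gen i).
Proof. by move=> x; apply: vl_inj; rewrite !vl_gen gen_intK. Qed.

Lemma gen_invg n (i : 'I_n) : ((gen i)^-1 = gen i)%g.
Proof. by apply/permP => x; apply: (canLR (permK _)); rewrite genK. Qed.

Lemma bcompE n (u v : {perm pt n}) x : bcomp u v x = u (v x).
Proof. exact: permM. Qed.

Lemma bcompA n (u v w : {perm pt n}) : bcomp u (bcomp v w) = bcomp (bcomp u v) w.
Proof. by rewrite /bcomp mulgA. Qed.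

Lemma bcomp1 n (u : {perm pt n}) : bcomp u 1%g = u.
Proof. exact: mul1g. Qed.

Lemma bcomp_genK n (i : 'I_n) : cancel (bcomp (gen i)) (bcomp (gen i)).
Proof. by move=> w; apply/permP => x; rewrite !bcompE genK. Qed.

Lemma bcomp_gen_inv n (i : 'I_n) (w : {perm pt n}) x :
  (bcomp (gen i) w)^-1%g x = w^-1%g (gen i x).
Proof. by rewrite /bcomp invMg gen_invg permM. Qed.

Lemma Bn1 n : 1%g \in Bn n.
Proof. by apply/BnP => x; rewrite !perm1. Qed.

Lemma Bn_bcomp n (u v : {perm pt n}) : u \in Bn n -> v \in Bn n -> bcomp u v \in Bn n.
Proof. by move=> /BnP hu /BnP hv; apply/BnP => x; rewrite !bcompE hv hu. Qed.

Lemma Bn_inv n (u : {perm pt n}) : u \in Bn n -> (u^-1)%g \in Bn n.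
Proof.
by move=> /BnP hu; apply/BnP => x; apply: (canLR (permK _)); rewrite hu permKV.
Qed.

Lemma gen_Bn n (i : 'I_n) : gen i \in Bn n.
Proof. by apply/BnP => x; apply: vl_inj; rewrite vl_negp !vl_gen vl_negp gen_intN. Qed.

Lemma gen_comm n (i j : 'I_n) : i.+1 < j -> bcomp (gen i) (gen j) = bcomp (gen j) (gen i).
Proof.
by move=> ij; apply/permP => x; apply: vl_inj; rewrite !bcompE !vl_gen gen_intC.
Qed.

Lemma winN n (w : {perm pt n}) (i : 'I_n) :
  w \in Bn n -> (vl (w (true, i)) = - win w i)%R.
Proof. by move=> /BnP h; rewrite winE -vl_negp -h. Qed.

Lemma win_neq n (w : {perm pt n}) i j : w \in Bn n -> i < n -> j < n ->
  i != j -> win w i <> win w j /\ (win w i <> - win w j)%R.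
Proof.
move=> wB hi hj ij; have /= e := winN (Ordinal hj) wB.
rewrite -e (winE w (Ordinal hi)) (winE w (Ordinal hj)).
by split=> /vl_inj/perm_inj [] // /eqP; rewrite (negPf ij).
Qed.

Lemma win_range n (w : {perm pt n}) i : i < n ->
  (0 < win w i <= n%:Z)%R \/ (- n%:Z <= win w i < 0)%R.
Proof. by move=> hi; rewrite (winE w (Ordinal hi)); apply: vl_range. Qed.

Lemma win_ext n (w w' : {perm pt n}) : w \in Bn n -> w' \in Bn n ->
  (forall i, i < n -> win w i = win w' i) -> w = w'.
Proof.
move=> wB wB' h; apply/permP => -[[] i]; apply: vl_inj.
  by rewrite !winN // h.
by rewrite -!winE h.
Qed.

Definition swap_neg (i : nat) (u : nat -> int) (k : nat) : int :=
  (if i is i'.+1 then u (if k == i' then i else if k == i then i' else k)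
  else if k == 0%N then - u 0%N else u k)%R.

Lemma win_gen n (w : {perm pt n}) (i : 'I_n) k : w \in Bn n -> k < n ->
  win (bcomp (gen i) w)^-1%g k = swap_neg i (win w^-1%g) k.
Proof.
move=> wB hk; rewrite (winE _ (Ordinal hk)) bcomp_gen_inv genE -!(inj_eq val_inj) /= /swap_neg.
case: i => [[|i] hi] /=.
  case: eqP => [k0|_]; last by rewrite (winE _ (Ordinal hk)).
  have -> : 0 = Ordinal hk by rewrite /= k0.
  by rewrite winN ?Bn_inv.
case: (k =P i.+1) => [->|h1].
  have hi' : i < n by lia.
  rewrite [i.+1 == i]eqn_leq ltnn /= (winE _ (Ordinal hi')).
  by congr (vl (_ (_, _))); apply: val_inj.
case: (k =P i) => [_|h2]; first by rewrite (winE _ (Ordinal hi)).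
by rewrite (winE _ (Ordinal hk)).
Qed.

(** * Descents and Coxeter length *)

Definition descent (u : nat -> int) (i : nat) : bool :=
  (if i is i'.+1 then u i < u i' else u 0%N < 0)%R.

(** A squeeze: without descents the entries are positive and strictly increasing, so induction from
    the left bounds entry [k] below by k+1, and induction from the right, starting at the maximum n,
    bounds it above by k+1. *)
Lemma increasing_window_id n (w : {perm pt n}) : w \in Bn n ->
  (forall i, i < n -> ~~ descent (win w) i) -> w = 1%g.
Proof.
move=> wB h.
have lo k : k < n -> (k.+1%:Z <= win w k)%R.
  elim: k => [|k IH] hk; have := h _ hk; rewrite /descent.
    by have := win_range w hk; lia.
  have hk' : k < n by lia.
  have := win_neq wB hk hk'; have := IH hk'; lia.
have up k : k < n -> (win w (n - k.+1)%N <= (n - k)%:Z)%R.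
  elim: k => [|k IH] hk.
    have hk' : n - 1 < n by lia.
    have := win_range w hk'; lia.
  have hk1 : n - k.+1 < n by lia.
  have hk2 : n - k.+2 < n by lia.
  have := h _ hk1; have := win_neq wB hk1 hk2.
  have -> : n - k.+1 = (n - k.+2).+1 by lia.
  have := IH (ltnW hk); have -> : n - k.+1 = (n - k.+2).+1 by lia.
  rewrite /descent; lia.
apply: win_ext => [||i hi]; rewrite ?Bn1 //.
rewrite (winE 1 (Ordinal hi)) perm1 /vl /=.
have hi' : n - i.+1 < n by lia.
have := lo _ hi; have := up _ hi'; have -> : n - (n - i.+1).+1 = i by lia.
lia.
Qed.

(* Twice the Coxeter length: inversions on the 2n points come in pairs z, -z,
   except those of the form (x, -x), which therefore count double. *)
Definition len2 n (w : {perm pt n}) : nat :=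
  \sum_(z : pt n * pt n | (vl z.1 < vl z.2)%R && (vl (w^-1%g z.2) < vl (w^-1%g z.1))%R)
    (1 + (z.2 == negp z.1)).

Lemma len2_1 n : len2 (1%g : {perm pt n}) = 0.
Proof. by rewrite /len2 big_pred0 // => z; rewrite invg1 !perm1; lia. Qed.

(** The values exchanged by s_i are neighbours among the nonzero integers (-1 and 1 when i = 0), so
    only an exchanged pair can change its order. *)
Lemma gen_int_lt s a b : (a != 0)%R -> (b != 0)%R -> b != gen_int s a ->
  (gen_int s a < gen_int s b)%R = (a < b)%R.
Proof. by case: s => [|s]; rewrite /gen_int; repeat case: ifP; lia. Qed.

Lemma vl_neq0 n (x : pt n) : (vl x != 0)%R.
Proof. by have := vl_range x; lia. Qed.

Lemma gen_lt n (s : 'I_n) (x y : pt n) : y != gen s x ->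
  (vl (gen s x) < vl (gen s y))%R = (vl x < vl y)%R.
Proof.
move=> h; rewrite !vl_gen gen_int_lt ?vl_neq0 // -vl_gen.
by apply: contra h => /eqP/vl_inj ->.
Qed.

Lemma gen_raises n (s : 'I_n) (x : pt n) :
  (vl x < vl (gen s x))%R =
  (x == (true, s)) || (val s != 0) && (x == (false, pred_ord s)).
Proof.
case: x s => b [j hj] [[|s] hs];
  rewrite genE !xpair_eqE -!(inj_eq val_inj) /= /vl ?andbF ?orbF.
  by case: b => /=; repeat (case: ifP => /=); lia.
by case: b => /=; repeat (case: ifP => /=); lia.
Qed.

Lemma pred_ord_neq n (s : 'I_n) : val s != 0 -> (pred_ord s == s) = false.
Proof. by move=> /= s0; apply/negP => /eqP/(congr1 val) /=; lia. Qed.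

(** After reindexing by s, pairs not exchanged by s count equally for w and s w. Each pair (x, s x)
    with x raised by s is an inversion of w, by [drop], and not of s w, so the loss is the total
    weight of these pairs. *)
Lemma len2_descent n (w : {perm pt n}) (s : 'I_n) :
  w \in Bn n -> descent (win w^-1%g) s -> len2 w = (len2 (bcomp (gen s) w)).+2.
Proof.
move=> wB; set g := (w^-1)%g => ds.
have gB : g \in Bn n by apply: Bn_inv.
have drop x : (vl x < vl (gen s x) -> vl (g (gen s x)) < vl (g x))%R.
  rewrite gen_raises => /orP [/eqP -> | /andP [s0 /eqP ->]].
    have := winN s gB; move: ds; rewrite genE.
    case: (val s =P 0) => [s0|s0] ds e.
      rewrite eqxx /= e -winE; move: ds; rewrite /descent /= s0 => ds.
      by move: ds; lia.
    rewrite eqxx e winN //.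
    move: ds s0; rewrite /descent /=; case: (nat_of_ord s) => //= k; lia.
  rewrite genE (negPf s0) eqxx.
  rewrite pred_ord_neq // -!winE /=; move: ds s0; rewrite /descent /=.
  by case: (nat_of_ord s).
pose h (z : pt n * pt n) := (gen s z.1, gen s z.2).
have hK : involutive h by case=> x y; rewrite /h /= !genK.
have -> : len2 (bcomp (gen s) w) =
    \sum_(z | (vl (gen s z.1) < vl (gen s z.2))%R && (vl (g z.2) < vl (g z.1))%R)
     (1 + (z.2 == negp z.1)).
  rewrite /len2 (reindex_inj (can_inj hK)) /=; apply: eq_big => z.
    by rewrite !bcomp_gen_inv !genK.
  by move=> _; rewrite -(BnP _ (gen_Bn s)) (inj_eq perm_inj).
rewrite /len2 -/g (bigID (fun z => z.2 == gen s z.1)) /=.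
rewrite [in RHS](bigID (fun z => z.2 == gen s z.1)) /=.
rewrite [X in _ = (X + _).+2]big_pred0 => [|[x y] /=]; last first.
  case: eqP => [->|_]; rewrite ?andbF // genK andbT.
  apply/negP => /andP [h1 h2].
  by have := drop (gen s x); rewrite genK => /(_ h1); lia.
rewrite add0n -addn2 addnC; congr (_ + _).
  by apply: eq_bigl => -[x y] /=; case: eqP => [->|/eqP yx]; rewrite ?andbF ?andbT ?gen_lt.
have -> : \sum_(i | (vl i.1 < vl i.2)%R && (vl (g i.2) < vl (g i.1))%R && (i.2 == gen s i.1))
   (1 + (i.2 == negp i.1)) =
   \sum_(x | (vl x < vl (gen s x))%R) (1 + (gen s x == negp x)).
  rewrite (reindex_onto (fun x => (x, gen s x)) fst) /=; last first.
    by case=> x y /= /andP [_ /eqP ->].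
  by apply: eq_bigl => x; rewrite !eqxx !andbT;
    apply/andP/idP => [[]//|hx]; split=> //; apply: drop.
(* For s = 0 the only such pair is (-1, 1), of weight 2; otherwise there are two opposite pairs of
   weight 1. *)
rewrite (eq_bigl _ _ (gen_raises s)); case: (val s =P 0) => s0 /=.
  rewrite (big_pred1 (true, s)) => [|x /=]; last by rewrite orbF.
  by rewrite genE s0 !eqxx.
rewrite (bigD1 (true, s)) ?eqxx //= (big_pred1 (false, pred_ord s)) => [|x /=].
  rewrite !genE; have/eqP s0' := s0; rewrite (negPf s0').
  by rewrite !eqxx pred_ord_neq.
by case: eqP => [->|] //=; rewrite ?andbT // andbF.
Qed.

(** When s is not a descent of w, this lets [len2_descent] be applied to s w instead. *)
Lemma descent_gen n (w : {perm pt n}) (s : 'I_n) : w \in Bn n ->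
  descent (win (bcomp (gen s) w)^-1%g) s = ~~ descent (win w^-1%g) s.
Proof.
move=> wB; have gB := Bn_inv wB; rewrite /descent.
case e: (nat_of_ord s) => [|k]; have := ltn_ord s; rewrite e => hs.
  by rewrite win_gen // e /=; have := win_range (w^-1)%g hs; lia.
rewrite !win_gen ?e /swap_neg ?eqxx; try lia.
have -> : k.+1 == k = false by lia.
by have := @win_neq _ _ k.+1 k gB hs; lia.
Qed.

(** * Reduced words *)

Lemma wordProd_Bn n (a : seq 'I_n) : wordProd a \in Bn n.
Proof. by elim: a => [|s a IH] /=; [apply: Bn1 | apply: Bn_bcomp; rewrite ?gen_Bn]. Qed.

Lemma wordProd_cons n (s : 'I_n) a : wordProd (s :: a) = bcomp (gen s) (wordProd a).
Proof. by []. Qed.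

Lemma len2_wordProd n (a : seq 'I_n) : len2 (wordProd a) <= 2 * size a.
Proof.
elim: a => [|s a IH]; first by rewrite len2_1.
rewrite wordProd_cons /=; have aB := wordProd_Bn a.
case d: (descent (win (wordProd a)^-1%g) s).
  by have := len2_descent aB d; lia.
have d' : descent (win (bcomp (gen s) (wordProd a))^-1%g) s by rewrite descent_gen ?d.
rewrite (len2_descent (Bn_bcomp (gen_Bn s) aB) d') bcomp_genK; lia.
Qed.

(** Removing descents one at a time costs exactly 2 in [len2] per letter, and an element without
    descents is the identity. *)
Lemma short_word n (w : {perm pt n}) : w \in Bn n ->
  exists2 a, wordProd a = w & 2 * size a = len2 w.
Proof.
have [m] := ubnP (len2 w); elim: m w => // m IH w hm wB.
case: (pickP (fun s : 'I_n => descent (win w^-1%g) s)) => [s ds|nod].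
  have e := len2_descent wB ds.
  have [|a ha sa] := IH _ _ (Bn_bcomp (gen_Bn s) wB); first by lia.
  by exists (s :: a); rewrite ?wordProd_cons ?ha ?bcomp_genK //= e -sa; lia.
exists [::]; last first.
all: have e : (w^-1 = 1)%g by apply: increasing_window_id; [exact: Bn_inv |
  move=> i hi; have /= -> := nod (Ordinal hi)].
  by rewrite -[w]invgK e invg1 len2_1.
by rewrite -[w]invgK e invg1.
Qed.

(** Trades minimality over all words for a numerical equality: [len2_wordProd] bounds every word
    from below and [short_word] attains the bound. *)
Lemma reducedWordP n (w : {perm pt n}) a :
  reducedWord w a <-> wordProd a = w /\ 2 * size a = len2 w.
Proof.
split=> [[ha hmin]|[ha sa]]; split=> //.
  have wB : w \in Bn n by rewrite -ha wordProd_Bn.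
  have [b hb sb] := short_word wB; have := hmin _ hb.
  by have := len2_wordProd a; rewrite ha; lia.
by move=> b hb; have := len2_wordProd b; rewrite hb; lia.
Qed.

Lemma reducedWord_Bn n (w : {perm pt n}) a : reducedWord w a -> w \in Bn n.
Proof. by case=> <- _; apply: wordProd_Bn. Qed.

Lemma reducedWord_exists n (w : {perm pt n}) : w \in Bn n -> exists a, reducedWord w a.
Proof. by move=> /short_word [a ha sa]; exists a; apply/reducedWordP. Qed.

(** The recursive form of reducedness on which the later inductions run; a first letter that is not
    a descent would make the rest too short for its own product. *)
Lemma reducedWord_cons n (w : {perm pt n}) s a :
  reducedWord w (s :: a) <->
  [/\ w \in Bn n, descent (win w^-1%g) s & reducedWord (bcomp (gen s) w) a].
Proof.
split=> [h | [wB d /reducedWordP [ha sa]]].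
  have wB := reducedWord_Bn h; move/reducedWordP: h => [ha sa].
  have e : wordProd a = bcomp (gen s) w by rewrite -ha wordProd_cons bcomp_genK.
  have ea := len2_wordProd a; rewrite e in ea.
  case d: (descent (win w^-1%g) s).
    split=> //; apply/reducedWordP; split=> //.
    by move: sa; rewrite (len2_descent wB d) /=; lia.
  have d' : descent (win (bcomp (gen s) w)^-1%g) s by rewrite descent_gen ?d.
  have := len2_descent (Bn_bcomp (gen_Bn s) wB) d'.
  by rewrite bcomp_genK; move: sa => /=; lia.
apply/reducedWordP; rewrite wordProd_cons ha bcomp_genK; split=> //=.
by rewrite (len2_descent wB d); lia.
Qed.

(** * Forbidden patterns and the removal of a descent *)

(* The third pattern hides a 321: once the negative entry [u j] has been moved to
   the front and negated, it is followed by [u i > u k]. *)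
Definition fc_window (n : nat) (u : nat -> int) : Prop :=
  [/\ forall i j k, i < j -> j < k -> k < n -> (u k < u j)%R -> (u j < u i)%R -> False,
      forall i j, i < j -> j < n -> (u j < u i)%R -> (u i < 0)%R -> False &
      forall i j k, i < k -> j < k -> k < n ->
        (u j < 0)%R -> (0 < u i)%R -> (u i < - u j)%R -> (u k < u i)%R -> False].

(** The effect of [swap_neg m.+1] on positions: a pattern is carried between the two windows by
    relabelling its places. *)
Definition adj_tr (m k : nat) : nat := if k == m then m.+1 else if k == m.+1 then m else k.

Lemma adj_trK m : involutive (adj_tr m).
Proof. by move=> k; rewrite /adj_tr; repeat case: ifP; lia. Qed.

Lemma adj_tr_lt m x y : x < y -> (x != m) || (y != m.+1) -> adj_tr m x < adj_tr m y.
Proof. by rewrite /adj_tr; repeat case: ifP; lia. Qed.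

Lemma adj_tr_bound n m k : m.+1 < n -> k < n -> adj_tr m k < n.
Proof. by rewrite /adj_tr; repeat case: ifP; lia. Qed.

Lemma swap_neg_tr m u k : swap_neg m.+1 u k = u (adj_tr m k).
Proof. by []. Qed.

(** A forbidden pattern of the new window is traced back to one of the old window, possibly of
    another kind. *)
Lemma fc_window_descent n u s : (forall k, k < n -> u k <> 0%R) ->
  s < n -> descent u s -> fc_window n u -> fc_window n (swap_neg s u).
Proof.
move=> nz sn ds [Ha Hb Hc]; case: s sn ds => [|m] sn; rewrite /descent => ds.
  have gt0 i j : i < j -> (j == 0) = false by lia.
  split=> [i j k ij jk kn|i j ij jn|i j k ik jk kn]; rewrite /swap_neg.
  - rewrite (gt0 _ _ ij) (gt0 _ _ jk); case: eqP => [_ kj ji|_]; last exact: Ha.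
    have jn : j < n by lia.
    (* A 321 headed by the negated entry comes from the second pattern or, with the old negative
       entry at place 0, from the third. *)
    case: (boolP (u j < 0)%R) => uj; first exact: (Hb j k).
    by apply: (Hc j 0 k) => //; have := nz _ jn; lia.
  - by rewrite (gt0 _ _ ij); case: eqP => [_|_]; [lia | apply: Hb].
  - rewrite (gt0 _ _ ik); case: (j =P 0) => [_|j0]; first by lia.
    case: eqP => [_|_]; last exact: Hc.
    by move=> uj ui uij _; apply: (Hb 0 j) => //; lia.
(* A decreasing pair of the new window keeps its order, since places m and m+1 now carry an
   ascent. *)
have lt x y : x < y -> (u (adj_tr m y) < u (adj_tr m x))%R -> adj_tr m x < adj_tr m y.
  move=> xy; case: (boolP ((x != m) || (y != m.+1))) => [h _|]; first exact: adj_tr_lt.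
  rewrite negb_or !negbK => /andP [/eqP -> /eqP ->].
  rewrite /adj_tr !eqxx; have -> : (m.+1 == m) = false by lia.
  by lia.
have bd := adj_tr_bound sn.
split=> [i j k|i j|i j k]; rewrite !swap_neg_tr.
- by move=> ij jk kn kj ji; apply: (Ha (adj_tr m i) (adj_tr m j) (adj_tr m k)); rewrite ?bd ?lt.
- by move=> ij jn ji i0; apply: (Hb (adj_tr m i) (adj_tr m j)); rewrite ?bd ?lt.
move=> ik jk kn uj ui uij uki.
have ltik := lt _ _ ik uki.
have [ltjk|lekj] := ltnP (adj_tr m j) (adj_tr m k).
  by apply: (Hc (adj_tr m i) (adj_tr m j) (adj_tr m k)); rewrite ?bd.
(* Here j and k are the exchanged places, and the old window has a 321 with [u j] last. *)
apply: (Ha (adj_tr m i) (adj_tr m k) (adj_tr m j)) => //; rewrite ?bd //; try lia.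
  rewrite ltn_neqAle lekj andbT; apply/eqP => /(can_inj (adj_trK m)); lia.
have [/adj_tr_lt h|] := boolP ((j != m) || (k != m.+1)).
  by have := h jk; lia.
rewrite negb_or !negbK => /andP [/eqP -> /eqP ->].
by rewrite /adj_tr !eqxx; have -> : (m.+1 == m) = false by lia.
Qed.

Lemma descent_between (u : nat -> int) i j : i < j -> (u j < u i)%R ->
  exists2 m, i <= m < j & (u m.+1 < u m)%R.
Proof.
elim: j => // j IH; rewrite ltnS leq_eqVlt => /orP [/eqP -> d|ij d].
  by exists j => //; lia.
case: (boolP (u j.+1 < u j)%R) => d'; first by exists j => //; lia.
have [||m hm dm] := IH => //; first by lia.
by exists m => //; lia.
Qed.

(** Every forbidden pattern has a descent whose removal leaves a forbidden pattern, against the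
    first hypothesis, unless the pattern is tight, in which case two adjacent descents appear. *)
Lemma fc_window_of_descents n u :
  (forall s, s < n -> descent u s -> fc_window n (swap_neg s u)) ->
  (forall s, s.+1 < n -> descent u s -> descent u s.+1 -> False) ->
  fc_window n u.
Proof.
move=> IH adj.
have sw m k : swap_neg m.+1 u (adj_tr m k) = u k by rewrite swap_neg_tr adj_trK.
have sg k : k != 0 -> swap_neg 0 u k = u k by rewrite /swap_neg => /negPf ->.
have lt m x y : x < y -> (x, y) <> (m, m.+1) -> adj_tr m x < adj_tr m y.
  by move=> xy ne; apply: adj_tr_lt => //; apply: contraT;
    rewrite negb_or !negbK => /andP [/eqP e /eqP f];
    case: ne; rewrite e f.
have Ha i j k : i < j -> j < k -> k < n -> (u k < u j)%R -> (u j < u i)%R -> False.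
  move=> ij jk kn kj ji.
  (* Removing a descent that is not itself one of the two steps of the 321 preserves it. *)
  have use m : m.+1 < n -> (u m.+1 < u m)%R -> (i, j) <> (m, m.+1) ->
      (j, k) <> (m, m.+1) -> False.
    move=> mn dm n1 n2; have [Ha _ _] := IH m.+1 mn dm.
    by apply: (Ha (adj_tr m i) (adj_tr m j) (adj_tr m k)); rewrite ?sw ?lt ?adj_tr_bound.
  have [m /andP [m1 m2] dm] := descent_between ij ji.
  have [l /andP [l1 l2] dl] := descent_between jk kj.
  case: (j =P i.+1) => [ej|ne]; last by apply: (use m) => //; [lia | case; lia | case; lia].
  case: (k =P j.+1) => [ek|ne]; last by apply: (use l) => //; [lia | case; lia | case; lia].
  (* The tight case: three consecutive decreasing entries give the adjacent descents i+1 and i+2. *)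
  by rewrite ek ej in kn kj; rewrite ej in ji; apply: (adj i.+1).
have Hb i j : i < j -> j < n -> (u j < u i)%R -> (u i < 0)%R -> False.
  move=> ij jn ji i0.
  have use m : m.+1 < n -> (u m.+1 < u m)%R -> (i, j) <> (m, m.+1) -> False.
    move=> mn dm n1; have [_ Hb _] := IH m.+1 mn dm.
    by apply: (Hb (adj_tr m i) (adj_tr m j)); rewrite ?sw ?lt ?adj_tr_bound.
  case: (i =P 0) => [e|/eqP ne]; last first.
    have [u0|u0] := boolP (u 0%N < 0)%R.
      have [|_ Hb _] := IH 0 _ u0; first by lia.
      by apply: (Hb i j) => //; rewrite !sg //; lia.
    have [||m hm dm] := @descent_between u 0 i; [lia | lia |].
    by apply: (use m) => //; [lia | case; lia].
  have [m /andP [m1 m2] dm] := descent_between ij ji.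
  case: (j =P i.+1) => [ej|nej]; last by apply: (use m) => //; [lia | case; lia].
  (* The tight case: the pattern sits at places 0 and 1, giving the adjacent descents 0 and 1. *)
  by rewrite ej e in jn ji; rewrite e in i0; apply: (adj 0).
have Hc0 i j k : j < i -> i < k -> k < n ->
        (u j < 0)%R -> (0 < u i)%R -> (u i < - u j)%R -> (u k < u i)%R -> False.
  move=> ji ik kn uj ui uij uki.
  have [u0|u0] := boolP (u 0%N < 0)%R.
    have [|Ha' _ Hc'] := IH 0 _ u0; first by lia.
    have [j0|j0] := eqVneq j 0; last by apply: (Hc' i j k); rewrite ?sg //; lia.
    (* Negating the entry at place 0 turns the third pattern into a 321. *)
    by rewrite j0 in ji uij; apply: (Ha' 0 i k) => //; rewrite ?(sg i) ?(sg k) //; lia.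
  have j0 : j != 0 by apply/eqP => e; move: u0; rewrite -e uj.
  have [||m hm dm] := @descent_between u 0 j; [lia | lia |].
  have mn : m.+1 < n by lia.
  have [_ _ Hc'] := IH m.+1 mn dm.
  apply: (Hc' (adj_tr m i) (adj_tr m j) (adj_tr m k)); rewrite ?sw ?lt ?adj_tr_bound //;
    by [lia | case; lia].
split=> // i j k ik jk kn uj ui uij uki.
have [ij|ji|e] := ltngtP i j; last by rewrite e in ui; lia.
  have uji : (u j < u i)%R by lia.
  (* The third pattern does not fix the order of i and j, so it survives removing a descent between
     them. *)
  have [m hm dm] := descent_between ij uji.
  have mn : m.+1 < n by lia.
  have [_ _ Hc'] := IH m.+1 mn dm.
  apply: (Hc' (adj_tr m i) (adj_tr m j) (adj_tr m k)); rewrite ?sw ?lt ?adj_tr_bound //;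
    by [lia | case; lia].
exact: (Hc0 i j k).
Qed.

(** * Commutation classes and full commutativity *)

Lemma gen_noncomm n (i j : 'I_n) : val j = (val i).+1 ->
  bcomp (gen i) (gen j) <> bcomp (gen j) (gen i).
Proof.
(* The test point has value i, or 1 when i = 0, because [pred_ord] fixes 0. *)
move=> e /permP /(_ (false, pred_ord i)) /(congr1 (@vl n)).
rewrite !bcompE !vl_gen /vl /=; move: e => /= ->.
by rewrite /gen_int; case: (nat_of_ord i) => [|k] /=; repeat case: ifP; lia.
Qed.

Local Notation commEq n := (clos_refl_trans _ (@commStep n)).

Lemma commEq_cons n (s : 'I_n) a b : commEq n a b -> commEq n (s :: a) (s :: b).
Proof.
elim=> [{}a {}b [p [q [i [j [ij [c [-> ->]]]]]]] | {}a | {}a b1 {}b _ h1 _ h2].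
- by apply: rt_step; exists (s :: p), q, i, j.
- exact: rt_refl.
- exact: rt_trans h1 h2.
Qed.

Lemma rem_cat (T : eqType) (x : T) a b :
  rem x (a ++ b) = if x \in a then rem x a ++ b else a ++ rem x b.
Proof.
elim: a => //= y a IH; rewrite inE eq_sym; case: eqVneq => //= _.
by rewrite IH; case: ifP.
Qed.

(** If s is one of the two exchanged letters, its first occurrence disappears and both words become
    equal. The purpose is left cancellation, [commEq_consI]. *)
Lemma commEq_rem n (s : 'I_n) a b : commEq n a b -> commEq n (rem s a) (rem s b).
Proof.
elim=> [{}a {}b [p [q [i [j [ij [c [-> ->]]]]]]] | {}a | {}a b1 {}b _ h1 _ h2].
- rewrite !rem_cat; case: (s \in p); first by apply: rt_step; exists (rem s p), q, i, j.
  rewrite /=; have [e | si] := eqVneq i s.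
    by rewrite e in ij *; rewrite eq_sym (negPf ij); apply: rt_refl.
  case: eqVneq => [js|sj]; first exact: rt_refl.
  by apply: rt_step; exists p, (rem s q), i, j.
- exact: rt_refl.
- exact: rt_trans h1 h2.
Qed.

Lemma commEq_consI n (s : 'I_n) a b : commEq n (s :: a) (s :: b) -> commEq n a b.
Proof. by move=> /(commEq_rem s); rewrite /= eqxx. Qed.

(** Noncommuting letters are never exchanged, so the subword they form is an invariant of the
    commutation class. *)
Lemma commEq_filter n (s t : 'I_n) a b :
  bcomp (gen s) (gen t) <> bcomp (gen t) (gen s) -> commEq n a b ->
  [seq i <- a | (i == s) || (i == t)] = [seq i <- b | (i == s) || (i == t)].
Proof.
move=> nc; elim=> [{}a {}b [p [q [i [j [ij [c [-> ->]]]]]]] | // | {}a b1 {}b _ -> _ -> //].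
rewrite !filter_cat /=; congr (_ ++ _).
case: (i =P s) => [ei|_]; case: (j =P s) => [ej|_] //=;
  case: (i =P t) => [ei'|_]; case: (j =P t) => [ej'|_] //=; subst; rewrite ?eqxx // in ij nc *;
  by case: nc.
Qed.

Lemma FC_gen n (w : {perm pt n}) (s : 'I_n) :
  FC w -> w \in Bn n -> descent (win w^-1%g) s -> FC (bcomp (gen s) w).
Proof.
move=> fw wB ds a b ha hb; apply: (@commEq_consI n s); apply: fw; exact/reducedWord_cons.
Qed.

(** Reduced words starting with s and with t would be equivalent, yet their subwords in s and t
    begin differently. *)
Lemma FC_no_adjacent_descents n (w : {perm pt n}) (s t : 'I_n) :
  FC w -> w \in Bn n -> val t = (val s).+1 ->
  descent (win w^-1%g) s -> descent (win w^-1%g) t -> False.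
Proof.
move=> fw wB st ds dt.
have [a ha] := reducedWord_exists (Bn_bcomp (gen_Bn s) wB).
have [b hb] := reducedWord_exists (Bn_bcomp (gen_Bn t) wB).
have /(commEq_filter (gen_noncomm st)) : commEq n (s :: a) (t :: b).
  by apply: fw; apply/reducedWord_cons.
rewrite /= !eqxx orbT => -[/(congr1 val) /=]; move: st => /=; lia.
Qed.

Lemma fc_window_ext n u u' : (forall k, k < n -> u k = u' k) ->
  fc_window n u -> fc_window n u'.
Proof.
move=> e [Ha Hb Hc]; split=> [i j k ij jk kn|i j ij jn|i j k ik jk kn].
- by rewrite -!e //; [apply: Ha | lia..].
- by rewrite -!e //; [apply: Hb | lia..].
- by rewrite -!e //; [apply: Hc | lia..].
Qed.

Lemma win_neq0 n (w : {perm pt n}) k : k < n -> win w k <> 0%R.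
Proof. by move=> /(win_range w); lia. Qed.

Lemma FC_fc_window n (w : {perm pt n}) : w \in Bn n -> FC w -> fc_window n (win w^-1%g).
Proof.
have [m] := ubnP (len2 w); elim: m w => // m IH w hm wB fw.
apply: fc_window_of_descents => [s sn ds|s sn ds dt]; last first.
  exact: (@FC_no_adjacent_descents n w (Ordinal (ltnW sn)) (Ordinal sn)).
have gB := Bn_bcomp (gen_Bn (Ordinal sn)) wB.
have := IH _ _ gB (FC_gen (s := Ordinal sn) fw wB ds).
rewrite (@len2_descent n w (Ordinal sn)) // in hm.
move=> /(_ ltac:(lia)); apply: fc_window_ext => k kn.
by rewrite win_gen.
Qed.

Lemma fc_window_gen n (w : {perm pt n}) (s : 'I_n) : w \in Bn n ->
  descent (win w^-1%g) s -> fc_window n (win w^-1%g) ->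
  fc_window n (win (bcomp (gen s) w)^-1%g).
Proof.
move=> wB ds h.
apply: (@fc_window_ext n (swap_neg s (win w^-1%g))) => [k kn|]; first by rewrite win_gen.
by apply: fc_window_descent => // k; apply: win_neq0.
Qed.

Lemma fc_window_no_adjacent n u s :
  fc_window n u -> s.+1 < n -> descent u s -> descent u s.+1 -> False.
Proof.
move=> [Ha Hb _] sn; case: s sn => [|s] sn d d'; first by apply: (Hb 0 1).
by apply: (Ha s s.+1 s.+2).
Qed.

Lemma descent_gen_far n (w : {perm pt n}) (s t : 'I_n) : w \in Bn n ->
  (s.+1 < t) || (t.+1 < s) -> descent (win w^-1%g) t ->
  descent (win (bcomp (gen s) w)^-1%g) t.
Proof.
move=> wB st; rewrite /descent; move: (ltn_ord t) (ltn_ord s) (st).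
case et: (nat_of_ord t) => [|t'] ht hs far.
  by rewrite win_gen // /swap_neg; case: (nat_of_ord s) far => [|[|s']].
rewrite !win_gen //; last by lia.
rewrite /swap_neg; case: (nat_of_ord s) far => [|s'] /= h.
  by have -> : (t' == 0) = false by lia.
have -> : (t'.+1 == s') = false by lia.
have -> : (t'.+1 == s'.+1) = false by lia.
have -> : (t' == s') = false by lia.
by have -> : (t' == s'.+1) = false by lia.
Qed.

Lemma reducedWord_size n (w : {perm pt n}) a b :
  reducedWord w a -> reducedWord w b -> size a = size b.
Proof. by move=> /reducedWordP [_ ha] /reducedWordP [_ hb]; lia. Qed.

(** Induction on length. Distinct first letters s and t are both descents, hence not adjacent, hence
    commute; both words are then linked through s t c and t s c for a common reduced word [c]. *)
Lemma fc_window_FC n (w : {perm pt n}) : fc_window n (win w^-1%g) -> FC w.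
Proof.
move=> fw a; elim: {a}(size a) {-2}a (erefl (size a)) w fw => [|m IH] a sa w fw b ha hb.
  by rewrite (size0nil sa) (size0nil (etrans (reducedWord_size hb ha) sa)); apply: rt_refl.
have := reducedWord_size hb ha; rewrite sa.
case: a b sa ha hb => [|s a] // [|t b] // [sa] /reducedWord_cons [wB ds ha]
  /reducedWord_cons [_ dt hb] [sb].
have fs := fc_window_gen wB ds fw; have ft := fc_window_gen wB dt fw.
have [est|nst] := eqVneq s t.
  by rewrite -est in hb *; apply: commEq_cons; apply: (IH _ sa _ fs).
have far : (s.+1 < t) || (t.+1 < s).
  apply: contraT => near; exfalso.
  have [e|e] : val t = (val s).+1 \/ val s = (val t).+1.
    by move: near; have /eqP : val s != val t by []; move=> /=; lia.
  - by move: (ltn_ord t) dt; rewrite [nat_of_ord t]e => tn; apply: (fc_window_no_adjacent fw tn ds).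
  - by move: (ltn_ord s) ds; rewrite [nat_of_ord s]e => sn; apply: (fc_window_no_adjacent fw sn dt).
have com : bcomp (gen s) (gen t) = bcomp (gen t) (gen s).
  by case/orP: far => /gen_comm ->.
have sB := Bn_bcomp (gen_Bn s) wB; have tB := Bn_bcomp (gen_Bn t) wB.
have far' : (t.+1 < s) || (s.+1 < t) by rewrite orbC.
have dts := descent_gen_far wB far dt; have dst := descent_gen_far wB far' ds.
have [c hc] := reducedWord_exists (Bn_bcomp (gen_Bn t) sB).
have hc' : reducedWord (bcomp (gen s) (bcomp (gen t) w)) c.
  by rewrite bcompA com -bcompA.
have atc : commEq n a (t :: c) by apply: (IH _ sa _ fs) => //; apply/reducedWord_cons.
have bsc : commEq n (s :: c) b.
  apply: (IH _ _ _ ft) => //; last exact/reducedWord_cons.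
  by have := reducedWord_size ha ((reducedWord_cons _ _ _).2 (And3 sB dts hc)); rewrite /= sa.
apply: rt_trans (commEq_cons s atc) _; apply: rt_trans (commEq_cons t bsc).
by apply: rt_step; exists [::], c, s, t.
Qed.

(** * Products of the delta_i *)

Lemma bcomp1l n (u : {perm pt n}) : bcomp 1%g u = u.
Proof. exact: mulg1. Qed.

Lemma win_bcomp_pos n (u v : {perm pt n}) j i : j < n -> i < n ->
  win v j = i.+1%:Z%R -> win (bcomp u v) j = win u i.
Proof.
move=> hj hi; rewrite !(winE _ (Ordinal hj)) bcompE => e.
rewrite (winE _ (Ordinal hi)); congr (vl (u _)); exact: vl_inj.
Qed.

Lemma win_bcomp_neg n (u v : {perm pt n}) j i : u \in Bn n -> j < n -> i < n ->
  win v j = (- i.+1%:Z)%R -> win (bcomp u v) j = (- win u i)%R.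
Proof.
move=> uB hj hi; rewrite !(winE _ (Ordinal hj)) bcompE => e.
have /= <- := winN (Ordinal hi) uB; congr (vl (u _)); exact: vl_inj.
Qed.

Lemma win1 n k : k < n -> win (1%g : {perm pt n}) k = k.+1%:Z%R.
Proof. by move=> hk; rewrite (winE _ (Ordinal hk)) perm1. Qed.

Lemma deltaS n k (hk : k < n) : delta n k.+1 = bcomp (gen (Ordinal hk)) (delta n k).
Proof.
rewrite /delta -[k.+1]addn1 iotaD rev_cat /= /genN.
by case: insubP => [i _ e|]; [congr (bcomp (gen _) _); apply: val_inj | rewrite add0n hk].
Qed.

Lemma delta_Bn n k : delta n k \in Bn n.
Proof.
rewrite /delta; elim: (rev _) => [|i a IH] /=; first exact: Bn1.
by rewrite Bn_bcomp // /genN; case: insubP => [j _ _|_]; rewrite ?gen_Bn ?Bn1.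
Qed.

Lemma win_delta n k j : k < n -> j < n ->
  win (delta n k.+1) j = (if j == 0%N then - k.+1%:Z else if (j <= k)%N then j%:Z else j.+1%:Z)%R.
Proof.
move=> hk hj; rewrite (winE _ (Ordinal hj)); elim: k hk => [|k IH] hk.
  rewrite deltaS bcompE vl_gen /delta /= perm1 /vl /gen_int /=.
  by case: j hj => [|j] hj /=; repeat case: ifP; lia.
rewrite deltaS bcompE vl_gen (IH (ltnW hk)).
case: (j =P 0) => [j0|j0]; [|case: (leqP j k) => jk];
  by rewrite /gen_int /=; repeat case: ifP; lia.
Qed.

(** The product occurring in [Bpi] with an arbitrary first index, so that factors can be split off
    at either end; bit i of [bs] selects delta_(j+i). *)
Definition mu_prod n j (bs : seq bool) : {perm pt n} :=
  foldr (fun ib acc => bcomp (if ib.2 then delta n ib.1 else 1%g) acc) 1%g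
    (zip (iota j (size bs)) bs).

Lemma mu_prod_cons n j b bs :
  mu_prod n j (b :: bs) = bcomp (if b then delta n j else 1%g) (mu_prod n j.+1 bs).
Proof. by []. Qed.

Lemma mu_prod_rcons n j b bs :
  mu_prod n j (rcons bs b) =
  bcomp (mu_prod n j bs) (if b then delta n (j + size bs) else 1%g).
Proof.
elim: bs j => [|c bs IH] j.
  by rewrite /mu_prod /= addn0 bcomp1 /bcomp mulg1.
by rewrite rcons_cons !mu_prod_cons IH bcompA addSnnS.
Qed.

Lemma mu_prod_Bn n j bs : mu_prod n j bs \in Bn n.
Proof.
elim: bs j => [|b bs IH] j; first exact: Bn1.
by rewrite mu_prod_cons Bn_bcomp //; case: b; rewrite ?delta_Bn ?Bn1.
Qed.

Lemma mu_prod_false n j bs : ~~ has id bs -> mu_prod n j bs = 1%g.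
Proof.
elim: bs j => [|b bs IH] j //=; rewrite negb_or => /andP [/negPf -> h].
by rewrite mu_prod_cons IH // bcomp1.
Qed.

Lemma mu_prod_cat_false n j bs bs' : ~~ has id bs' ->
  mu_prod n j (bs ++ bs') = mu_prod n j bs.
Proof.
move=> h; elim: bs j => [|b bs IH] j; first by rewrite mu_prod_false.
by rewrite cat_cons !mu_prod_cons IH.
Qed.

Lemma mu_prod_single n j bs :
  (forall i i', nth false bs i -> nth false bs i' -> i = i') ->
  mu_prod n j bs = 1%g \/ exists2 i, nth false bs i & mu_prod n j bs = delta n (j + i).
Proof.
elim: bs j => [|b bs IH] j h; first by left.
case: b h => h.
  right; exists 0 => //; rewrite addn0 mu_prod_cons mu_prod_false /bcomp ?mul1g //.
  apply/(has_nthP false) => -[i _ hi]; by have := h 0 i.+1 isT hi.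
rewrite mu_prod_cons bcomp1l.
have [i i' hi hi'|->|[i hi ->]] := IH j.+1; [|by left|].
  by have := h i.+1 i'.+1 hi hi' => -[].
by right; exists i.+1; rewrite ?addnS.
Qed.

(** The common shape of the windows of products of delta_1, ..., delta_v. *)
Record increasing_upto n (v : nat) (X : nat -> int) : Prop := IncreasingUpto {
  inc_lt : forall a b, a < b -> b < n -> (X a < X b)%R;
  inc_lo : forall a, a < v -> (- v%:Z <= X a <= v%:Z)%R;
  inc_fix : forall a, v <= a -> a < n -> X a = a.+1%:Z%R }.

(** Induction on the last factor: right multiplication by delta_(k+1) drops the entry k+1 from place
    k and puts -(k+1) in front, below the k earlier entries, which are at least -k. *)
Lemma mu_prod_increasing n bs : size bs <= n ->
  increasing_upto n (size bs) (win (mu_prod n 1 bs)) /\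
  (forall i, nth false bs i ->
     exists2 a, a < n & win (mu_prod n 1 bs) a = (- i.+1%:Z)%R).
Proof.
elim/last_ind: bs => [|bs b IH] sn.
  split=> [|i]; last by rewrite nth_nil.
  split=> // [a c ac cn | a _ an]; last by rewrite win1.
  by rewrite !win1; lia.
rewrite size_rcons in sn *; have [[lt lo fx] ng] := IH (ltnW sn).
set k := size bs in sn lo fx *.
have kX := fx k (leqnn k) sn.
rewrite mu_prod_rcons; set mu := mu_prod n 1 bs in lt lo fx ng kX *.
have muB : mu \in Bn n := mu_prod_Bn _ _ _.
case: b; last first.
  rewrite bcomp1; split.
    split=> // [a ak|a ka an]; last by apply: fx => //; lia.
    have [e|/lo] : a = k \/ a < k by lia.
      by rewrite e kX; lia.
    by lia.
  by move=> i; rewrite nth_rcons -/k; case: ltnP => [_|_]; [apply: ng | rewrite if_same].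
rewrite add1n -/k.
have X0 : win (bcomp mu (delta n k.+1)) 0 = (- k.+1%:Z)%R.
  by rewrite (@win_bcomp_neg _ _ _ _ k) // ?kX ?win_delta //; lia.
have X1 a : a < k -> win (bcomp mu (delta n k.+1)) a.+1 = win mu a.
  by move=> ak; apply: win_bcomp_pos; rewrite ?win_delta /= ?ak //; lia.
have X2 a : k < a -> a < n -> win (bcomp mu (delta n k.+1)) a = a.+1%:Z%R.
  move=> ka an; rewrite -fx ?(ltnW ka) //; apply: win_bcomp_pos => //.
  by rewrite win_delta // leqNgt ka /=; case: a ka {an}.
split; first split.
- move=> [|a] [|b] // ab bn.
    rewrite X0; have [bk|bk] := ltnP b k; first by rewrite X1 //; have := lo b bk; lia.
    by rewrite X2 //; lia.
  have [bk|bk] := ltnP b k; first by rewrite !X1 //; [apply: lt; lia | lia].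
  have [ak|ak] := ltnP a k; last by rewrite !X2 //; lia.
  by rewrite X1 // X2 //; have := lo a ak; lia.
- move=> [|a] ak; first by rewrite X0; lia.
  by rewrite X1 //; have := lo a ak; lia.
- by move=> a ka an; rewrite X2.
move=> i; rewrite nth_rcons -/k; case: ltnP => [ik|ki].
  move=> /ng [a an e]; have ak : a < k.
    by rewrite ltnNge; apply/negP => ka; have := fx a ka an; lia.
  by exists a.+1; rewrite ?X1 //; lia.
case: eqP => // -> _; exists 0 => //; lia.
Qed.

(** Greedy choice: if entry k of the remaining window is negative, delta_(k+1) is split off, which
    moves that entry to the front with its sign changed and shifts the positive entries before
    it. *)
Lemma mu_prod_decomposition n (w : {perm pt n}) k : w \in Bn n -> k <= n ->
  exists bs w', [/\ size bs = k, w' \in Bn n, w = bcomp (mu_prod n 1 bs) w' &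
    forall i, i < k -> (0 < win w'^-1%g i)%R].
Proof.
move=> wB; elim: k => [|k IH] kn.
  by exists [::], w; split=> //; rewrite /mu_prod /= /bcomp mulg1.
have [bs [w' [sb wB' e pos]]] := IH (ltnW kn).
case: (boolP (0 < win w'^-1%g k)%R) => hk.
  exists (rcons bs false), w'; rewrite size_rcons sb mu_prod_rcons; split=> //.
    by rewrite bcomp1.
  by move=> i; rewrite ltnS leq_eqVlt => /orP [/eqP -> //|]; apply: pos.
have dB : (delta n k.+1)^-1%g \in Bn n by apply: Bn_inv; apply: delta_Bn.
exists (rcons bs true), (bcomp (delta n k.+1)^-1%g w').
rewrite size_rcons sb mu_prod_rcons sb add1n; split=> //; first exact: Bn_bcomp.
  by rewrite e -bcompA; congr (bcomp _ _); rewrite bcompA /bcomp mulVg mulg1.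
have -> : (bcomp (delta n k.+1)^-1 w')^-1%g = bcomp w'^-1%g (delta n k.+1).
  by rewrite /bcomp invMg invgK.
have iB := Bn_inv wB'.
move=> [|i] ik.
  have n0 : 0 < n by lia.
  rewrite (@win_bcomp_neg _ _ _ _ k) ?win_delta //.
  by have := @win_neq0 _ w'^-1%g _ kn; lia.
rewrite (@win_bcomp_pos _ _ _ _ i) ?pos ?win_delta //= ?ifT //; lia.
Qed.

(** * Comparing the windows of mu p and p; the first valley *)

Lemma inSn_win_gt0 n (p : {perm pt n}) i : inSn p -> i < n -> (0 < win p^-1%g i)%R.
Proof.
move=> [_ h] hi; rewrite (winE _ (Ordinal hi)); have := h (p^-1%g (false, Ordinal hi)).
by rewrite permKV /vl => <-.
Qed.

Lemma win_gt0_inSn n (p : {perm pt n}) : p \in Bn n ->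
  (forall i, i < n -> (0 < win p^-1%g i)%R) -> inSn p.
Proof.
move=> pB h; split=> // x.
rewrite -[in RHS](permK p x); case: (p x) => b i.
have := h _ (ltn_ord i); rewrite winE; case: b.
  by have := winN i (Bn_inv pB); rewrite winE /vl /=;
    case: (p^-1%g _).1; case: (p^-1%g _).1 => //; lia.
by rewrite /vl /=; case: (p^-1%g _).1 => //; lia.
Qed.

(** Since (mu p)^-1 = p^-1 mu^-1, entry i is read from the place a where mu has the entry i+1 or
    -(i+1), with the same sign. *)
Lemma win_bcomp_position n (mu p : {perm pt n}) i : mu \in Bn n -> p \in Bn n -> i < n ->
  exists2 a, a < n &
    win mu a = i.+1%:Z%R /\ win (bcomp mu p)^-1%g i = win p^-1%g a \/
    win mu a = (- i.+1%:Z)%R /\ win (bcomp mu p)^-1%g i = (- win p^-1%g a)%R.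
Proof.
move=> muB pB hi.
case e: (mu^-1%g (false, Ordinal hi)) => [b a]; exists a => //.
have e' : mu (b, a) = (false, Ordinal hi) by rewrite -e permKV.
have -> : win (bcomp mu p)^-1%g i = vl (p^-1%g (b, a)).
  by rewrite (winE _ (Ordinal hi)) /bcomp invMg permM e.
have /(congr1 (@vl n)) := e'; rewrite [in RHS]/vl /=.
case: b {e e'} => e; [right | left]; last by rewrite !winE.
rewrite winN ?Bn_inv //; split=> //; move: e; rewrite winN //; lia.
Qed.

Lemma win_bcomp_value n (mu p : {perm pt n}) a : mu \in Bn n -> p \in Bn n -> a < n ->
  exists2 i, i < n &
    win mu a = i.+1%:Z%R /\ win (bcomp mu p)^-1%g i = win p^-1%g a \/
    win mu a = (- i.+1%:Z)%R /\ win (bcomp mu p)^-1%g i = (- win p^-1%g a)%R.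
Proof.
move=> muB pB ha; have iB := Bn_inv pB.
have inv : bcomp (bcomp mu p)^-1%g mu = p^-1%g.
  by rewrite /bcomp invMg mulgA mulgV mul1g.
have wB : (bcomp mu p)^-1%g \in Bn n by apply/Bn_inv/Bn_bcomp.
have [h|h] := win_range mu ha; exists (`|win mu a|.-1)%N; try lia.
  by left; split; [lia | rewrite -inv; apply/esym/win_bcomp_pos; lia].
right; split; first by lia.
by rewrite -inv (@win_bcomp_neg _ _ _ _ (`|win mu a|.-1)%N) //; lia.
Qed.

Lemma desInvE n (p : {perm pt n}) i : inSn p -> 0 < i -> i < n ->
  desInv p i = descent (win p^-1%g) i.
Proof.
move=> pS i0 hi; rewrite /desInv; have -> : 1 <= i <= n - 1 by lia.
have ev k : k < n -> win p^-1%g k = (invVal p k).+1%:Z%R.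
  move=> hk; have := inSn_win_gt0 pS hk; rewrite (winE _ (Ordinal hk)) /invVal.
  case: insubP => [j _ ej|]; last by rewrite hk.
  have -> : Ordinal hk = j by apply: val_inj.
  by rewrite /vl /=; case: ((p^-1)%g _).1; lia.
case: i i0 hi => // i _ hi; rewrite /descent !ev ?subSS ?subn0 //=; lia.
Qed.

(** The default of [head] is the end of the range, matching the convention v(p) = n when no descent
    beyond 1 exists. *)
Lemma head_filter_iota (P : pred nat) m k (v := head (m + k) [seq i <- iota m k | P i]) :
  [/\ m <= v <= m + k, forall d, m <= d < v -> ~~ P d & v < m + k -> P v].
Proof.
rewrite /v {v}; elim: k m => [|k IH] m /=; first by rewrite addn0; split=> [|d|]; lia.
case: ifP => Pm /=; first by split=> // [|d]; lia.
have [] := IH m.+1; rewrite addSnnS => h1 h2 h3; split=> // [|d hd]; first by lia.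
have [->|ne] := eqVneq d m; first by rewrite Pm.
by apply: h2; lia.
Qed.

Lemma valleyP n (p : {perm pt n}) : 2 <= n ->
  [/\ 2 <= valley p <= n, forall d, 2 <= d < valley p -> ~~ desInv p d &
      valley p < n -> desInv p (valley p)].
Proof. by move=> hn; have := head_filter_iota (desInv p) 2 (n - 2); rewrite subnKC. Qed.

(** For the last claim: if 1 is a descent, mu has at most one factor, and the only negative entry of
    a delta_i is its first. *)
Lemma Bpi_increasing n (p mu : {perm pt n}) : 2 <= n -> Bpi p mu ->
  [/\ mu \in Bn n, increasing_upto n (valley p) (win mu) &
      desInv p 1 -> forall a, 0 < a < n -> (0 < win mu a)%R].
Proof.
move=> hn; have [/andP [v2 vn] _ _] := valleyP p hn.
rewrite /Bpi; case: ifP => [/negPf d1 [bs [sb]]|_].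
  rewrite -sb -/(mu_prod n 1 bs) => ->; split; rewrite ?mu_prod_Bn ?d1 //.
  by apply: (mu_prod_increasing _).1; rewrite sb.
case=> [->|[i [hi ->]]].
  split; rewrite ?Bn1 //; last by move=> _ a han; rewrite win1; lia.
  by split=> [a b ab bn|a av|a av an]; rewrite !win1; lia.
case: i hi => // i hi; have hin : i < n by lia.
split; rewrite ?delta_Bn //.
  split=> [a b ab bn|a av|a av an]; rewrite !win_delta //; try lia;
    by repeat case: ifP; lia.
by move=> _ a han; rewrite win_delta; try lia; repeat case: ifP; lia.
Qed.

(** * Pattern avoidance and uniqueness for a product mu p *)

Lemma window_increasing n (p : {perm pt n}) l v : p \in Bn n -> v <= n ->
  (forall d, l < d < v -> ~~ descent (win p) d) ->
  forall a b, l <= a -> a < b -> b < v -> (win p a < win p b)%R.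
Proof.
move=> pB vn h a b la; elim: b => // b IH ab bv.
have := h b.+1; rewrite /descent => /(_ ltac:(lia)) => nd.
have [ne _] := @win_neq _ p b.+1 b pB ltac:(lia) ltac:(lia) ltac:(lia).
have [->|ab'] := eqVneq a b; first by lia.
have : (win p a < win p b)%R by apply: IH; lia.
lia.
Qed.

(** As the window of mu increases, signs and positions of a pattern determine the order of the
    corresponding places in p^-1. The pattern then gives either an inversion of p^-1 among the first
    v places, excluded by monotonicity, or a 321 in p^-1. *)
Lemma fc_window_bcomp n (mu p : {perm pt n}) v : mu \in Bn n -> inSn p ->
  increasing_upto n v (win mu) ->
  (forall a b, 0 < a -> a < b -> b < v -> (win p^-1%g a < win p^-1%g b)%R) ->
  (win p^-1%g 0%N < win p^-1%g 1%N)%R \/ (forall a, 0 < a < n -> (0 < win mu a)%R) ->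
  fc_window n (win p^-1%g) -> fc_window n (win (bcomp mu p)^-1%g).
Proof.
move=> muB pS [lt lo fx] inc alt [Ha _ _]; have [pB _] := pS.
have le_of a b : a < n -> b < n -> (win mu a < win mu b)%R -> a < b.
  move=> an bn h; rewrite ltnNge leq_eqVlt; apply/negP => /orP [/eqP e|ba].
    by move: h; rewrite e; lia.
  by have := lt _ _ ba an; lia.
have gt0 a (an : a < n) := inSn_win_gt0 pS an.
have pos i (hi : i < n) := win_bcomp_position muB pB hi.
have neg_small a : a < n -> (win mu a < 0)%R -> a < v.
  by move=> an h; rewrite ltnNge; apply/negP => va; have := fx a va an; lia.
have small a : a < n -> (win mu a <= v%:Z)%R -> a < v.
  by move=> an h; rewrite ltnNge; apply/negP => va; have := fx a va an; lia.
have inc0 a b : a < b -> b < v -> b < n -> (win p^-1%g 0%N < win p^-1%g 1%N)%R ->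
    (win p^-1%g a < win p^-1%g b)%R.
  move=> ab bv bn h01; case: a ab => [|a] ab; last exact: inc.
  have [<-//|b1] := eqVneq 1 b.
  by have := inc 1 b isT ltac:(lia) bv; lia.
(* Two negative entries of mu rule out the second alternative of [alt], so p^-1 increases from place
   0 on. *)
have two a b : a < b -> b < n -> (win mu b < 0)%R ->
    (win p^-1%g 0%N < win p^-1%g 1%N)%R.
  by move=> ab bn h; case: alt => // /(_ b ltac:(lia)); lia.
have Hb i j : i < j -> j < n -> (win (bcomp mu p)^-1%g j < win (bcomp mu p)^-1%g i)%R ->
    (win (bcomp mu p)^-1%g i < 0)%R -> False.
  move=> ij jn ji i0; have hi : i < n by lia.
  have [a an ha] := pos _ hi; have [b bn hb] := pos _ jn.
  have := gt0 a an; have := gt0 b bn => qb qa.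
  have ba : b < a by apply: le_of => //; lia.
  have a0 : (win mu a < 0)%R by lia.
  by have := inc0 b a ba (neg_small _ an a0) an (two _ _ ba an a0); lia.
split=> // i j k.
  move=> ij jk kn kj ji.
  have jn : j < n by lia.
  have hi : i < n by lia.
  case: (boolP (win (bcomp mu p)^-1%g j < 0)%R) => j0.
    exact: (Hb j k).
  have [a an ha] := pos _ hi; have [b bn hb] := pos _ jn; have [c cn hc] := pos _ kn.
  have := gt0 a an; have := gt0 b bn; have := gt0 c cn => qc qb qa.
  have ab : a < b by apply: le_of => //; lia.
  case: hc => -[c1 c2]; last first.
    have cv := lo c (neg_small _ cn ltac:(lia)).
    have bv : b < v by apply: small => //; lia.
    have ca : c < a by apply: le_of => //; lia.
    by have := inc a b ltac:(lia) ab bv; lia.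
  have bc : b < c by apply: le_of => //; lia.
  by apply: (Ha a b c) => //; lia.
move=> ik jk kn uj ui uij uki.
have jn : j < n by lia.
have hi : i < n by lia.
have [a an ha] := pos _ hi; have [b bn hb] := pos _ jn; have [c cn hc] := pos _ kn.
have := gt0 a an; have := gt0 b bn; have := gt0 c cn => qc qb qa.
have ba : b < a by apply: le_of => //; lia.
case: hc => -[c1 c2]; last first.
  have cv := lo c (neg_small _ cn ltac:(lia)).
  have av : a < v by apply: small => //; lia.
  have cb : c < b by apply: le_of => //; lia.
  by have := inc0 b a ba av an (two _ _ cb bn ltac:(lia)); lia.
have ac : a < c by apply: le_of => //; lia.
by apply: (Ha b a c) => //; lia.
Qed.

(** Any failure of a conclusion exhibits a forbidden pattern in the window of (mu p)^-1. *)
Lemma fc_window_factor n (mu p : {perm pt n}) v : mu \in Bn n -> inSn p ->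
  increasing_upto n v (win mu) -> fc_window n (win (bcomp mu p)^-1%g) ->
  [/\ fc_window n (win p^-1%g),
      forall d a i, 1 < d -> d < n -> descent (win p^-1%g) d ->
        a < n -> win mu a = (- i.+1%:Z)%R -> i < d &
      descent (win p^-1%g) 1 -> forall a, 0 < a < n -> (0 < win mu a)%R].
Proof.
move=> muB pS [lt lo fx] [Ha Hb Hc]; have [pB _] := pS.
have gt0 a (an : a < n) := inSn_win_gt0 pS an.
have val_ a (hi : a < n) := win_bcomp_value muB pB hi.
have pos i (hi : i < n) := win_bcomp_position muB pB hi.
split.
- split=> [a b c ab bc cn cb ba|a b ab bn|a b c ac bc cn].
  + have bn : b < n by lia.
    have an : a < n by lia.
    have [i hi ha] := val_ _ an; have [j hj hb] := val_ _ bn; have [k hk hc] := val_ _ cn.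
    have := gt0 a an; have := gt0 b bn; have := gt0 c cn => qc qb qa.
    have := lt _ _ ab bn; have := lt _ _ bc cn => lbc lab.
    case: hb => -[b1 b2]; last by apply: (Hb j i); lia.
    case: ha => -[a1 a2]; first by apply: (Ha i j k); lia.
    (* Only the largest entry of the 321 has changed sign: the third pattern appears if it stands
       before the smallest, a new 321 otherwise. *)
    have [ik|ki|e] := ltngtP i k; [| |by rewrite e in a2; lia].
      by apply: (Hc j i k); lia.
    by apply: (Ha j k i); lia.
  + by have := gt0 a ltac:(lia); lia.
  + by have := gt0 b ltac:(lia); lia.
- move=> [|e] // a i e1 en de an Xa; rewrite ltnNge; apply/negP => id.
  have n0 : 0 < n by lia.
  have e'n : e < n by lia.
  have X0a : (win mu 0%N <= win mu a)%R.
    by case: a an Xa => // a an _; have := lt 0 a.+1 isT an; lia.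
  have [i0 hi0 h0] := val_ _ n0.
  have [ie hie he] := val_ _ e'n; have [jd hid hd] := val_ _ en.
  have := gt0 0 n0; have := gt0 e e'n; have := gt0 _ en => qd qe q0.
  have lt0e := lt 0 e e1 e'n; have lted := lt e e.+1 (ltnSn e) en.
  have [_ ne] := win_neq muB n0 en isT.
  (* This places the entry coming from place 0, which is negative, after those coming from the
     descent e, e+1; it serves as the last entry of the patterns below. *)
  have Xd : (win mu e.+1 < - win mu 0%N)%R.
    apply: contraT => ge; exfalso.
    (* Pigeonhole: by monotonicity each of 1, ..., - win mu 0 would be some
       |win mu a| with a <= e, although e < - win mu 0 - 1. *)
    have : size (iota 0 i0.+1) <= size [seq `|win mu a|.-1%N | a <- iota 0 e.+1].
      apply: uniq_leq_size; rewrite ?iota_uniq // => x; rewrite mem_iota => hx.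
      have [b bn hb] : exists2 b, b < n & (`|win mu b|.-1 = x)%N.
        by have [b bn hb] := pos x ltac:(lia); exists b => //; lia.
      apply/mapP; exists b => //; rewrite mem_iota ltnNge add0n /=; apply/negP => eb.
      have : (win mu e.+1 <= win mu b)%R.
        by move: eb; rewrite leq_eqVlt => /orP [/eqP <-|eb]; [lia | have := lt _ _ eb bn; lia].
      by lia.
    by rewrite size_map !size_iota; lia.
  move: de; rewrite /descent => de.
  case: hd => -[d1 d2]; last by apply: (Hb jd ie); lia.
  case: he => -[f1 f2]; first by apply: (Ha ie jd i0); lia.
  by apply: (Hc jd ie i0); lia.
- rewrite /descent => d1 a an.
  have an' : a < n by lia.
  have [i hi [[-> _]//|[Xa _]]] := val_ _ an'; exfalso.
  have n1 : 1 < n by lia.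
  have n0 : 0 < n by lia.
  have X1a : (win mu 1%N <= win mu a)%R.
    have [->|a1] := eqVneq a 1; first by lia.
    by have := lt 1 a ltac:(lia) an'; lia.
  have [i0 hi0 h0] := val_ _ n0; have [i1 hi1 h1] := val_ _ n1.
  have := gt0 0 n0; have := gt0 1 n1; have := lt 0 1 isT n1 => l01 q1 q0.
  by apply: (Hb i1 i0); lia.
Qed.

(** The permutation p1 p2^-1 carries the increasing window of mu1 to the increasing window of mu2,
    so it has no descents and is the identity. *)
Lemma factor_unique n (p1 p2 mu1 mu2 : {perm pt n}) v1 v2 :
  mu1 \in Bn n -> mu2 \in Bn n -> inSn p1 -> inSn p2 ->
  increasing_upto n v1 (win mu1) -> increasing_upto n v2 (win mu2) ->
  bcomp mu1 p1 = bcomp mu2 p2 -> p1 = p2.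
Proof.
move=> m1B m2B p1S p2S [lt1 _ _] [lt2 _ _] e.
have [p1B _] := p1S; have [p2B _] := p2S.
have pe : bcomp mu1 (bcomp p1 p2^-1%g) = mu2.
  by rewrite bcompA e -bcompA /bcomp mulVg mul1g.
have rB : bcomp p1 p2^-1%g \in Bn n by rewrite Bn_bcomp ?Bn_inv.
suff : bcomp p1 p2^-1%g = 1%g.
  by rewrite /bcomp => /(congr1 (mulg p2)); rewrite mulgA mulgV mul1g mulg1.
have gt0 i : i < n -> (0 < win (bcomp p1 p2^-1%g) i)%R.
  move=> hi; have := inSn_win_gt0 p2S hi; rewrite !(winE _ (Ordinal hi)) bcompE.
  by rewrite /vl; have [_ ->] := p1S; case: (p2^-1%g _).1.
have val_ i : i < n -> exists2 a, a < n & win (bcomp p1 p2^-1%g) i = a.+1%:Z%R /\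
    win mu2 i = win mu1 a.
  move=> hi; have := gt0 i hi; have := win_range (bcomp p1 p2^-1%g) hi => h1 h2.
  exists (`|win (bcomp p1 p2^-1%g) i|.-1)%N; first by lia.
  by split; [lia | rewrite -[in LHS]pe; apply: win_bcomp_pos; lia].
apply: increasing_window_id => // -[|i] hi; rewrite /descent.
  by have := gt0 0 hi; lia.
have [a an [ea ma]] := val_ _ hi; have [b bn [eb mb]] := val_ _ (ltnW hi).
rewrite ea eb; have := lt2 i i.+1 (ltnSn i) hi; rewrite ma mb => h.
apply/negP => ab; have ab' : a < b by lia.
by have := lt1 _ _ ab' bn; lia.
Qed.

(** * The disjoint union decomposition of FC(B_n) *)

Theorem mainTheorem4 (n : nat) (hn : 2 <= n) :
  (forall w : {perm pt n}, w \in Bn n ->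
     (FC w <-> exists p mu : {perm pt n}, FC_Sn p /\ Bpi p mu /\ w = bcomp mu p)) /\
  (forall p1 p2 mu1 mu2 : {perm pt n},
     FC_Sn p1 -> FC_Sn p2 -> Bpi p1 mu1 -> Bpi p2 mu2 ->
     bcomp mu1 p1 = bcomp mu2 p2 -> p1 = p2).
Proof.
split; last first.
  move=> p1 p2 mu1 mu2 [p1S _] [p2S _] /(Bpi_increasing hn) [m1B i1 _].
  by move=> /(Bpi_increasing hn) [m2B i2 _]; apply: factor_unique i1 i2.
move=> w wB; split=> [fw|[p [mu [[pS fp] [hmu ->]]]]]; last first.
  have [muB inc one] := Bpi_increasing hn hmu; have [pB _] := pS.
  have [/andP [v2 vn] nod _] := valleyP p hn.
  have iB := Bn_inv pB.
  apply: fc_window_FC; apply: (fc_window_bcomp muB pS inc); last exact: FC_fc_window.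
    apply: window_increasing => // d hd; rewrite -desInvE //; try lia.
    by apply: nod; lia.
  case d1: (desInv p 1); [right; exact: one | left].
  move: d1; rewrite desInvE // /descent => /negbT.
  by have := @win_neq _ p^-1%g 1 0 iB hn (ltnW hn) isT; lia.
have [bs [p [sb pB e pos]]] := mu_prod_decomposition wB (leqnn n).
have pS := win_gt0_inSn pB pos; have muB := mu_prod_Bn n 1 bs.
have [inc neg] : _ /\ _ := @mu_prod_increasing n bs (eq_leq sb).
have := FC_fc_window wB fw; rewrite e => /(fc_window_factor muB pS inc) [fp lim one].
have [/andP [v2 vn] _ des] := valleyP p hn.
(* Bit i selects delta_(i+1), so this bounds the selected indices by the valley. If the valley is
   below n it is a descent of p^-1 and [lim] applies. *)
have small i : nth false bs i -> i < valley p.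
  move=> hi; rewrite ltnNge; apply/negP => vi.
  have i_n : i < n.
    by rewrite ltnNge; apply/negP => ni; move: hi; rewrite nth_default // sb.
  have vn' : valley p < n by lia.
  have [a an ea] := neg i hi.
  have dv : descent (win p^-1%g) (valley p) by rewrite -desInvE ?des //; lia.
  by have := lim _ _ _ v2 vn' dv an ea; lia.
exists p, (mu_prod n 1 bs); split; first by split=> //; apply: fc_window_FC.
split=> //; rewrite /Bpi; case: ifP => [d1|/negbFE d1].
  have st : size (take (valley p) bs) = valley p by rewrite size_takel ?sb.
  exists (take (valley p) bs); split=> //.
  rewrite -[in LHS](cat_take_drop (valley p) bs) mu_prod_cat_false.
    by rewrite /mu_prod st.
  apply/(has_nthP false) => -[i _]; rewrite nth_drop => /small; lia.
(* When 1 is a descent of p^-1, every selected delta must account for the first entry of mu, so at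
   most one is selected. *)
have first_neg i : nth false bs i -> win (mu_prod n 1 bs) 0 = (- i.+1%:Z)%R.
  move=> /neg [[|a] an ea] //.
  by rewrite desInvE // in d1; have := one d1 a.+1 an; rewrite ea.
have [i i' /first_neg hi /first_neg|->|[i hi ->]] := @mu_prod_single n 1 bs; last 1 first.
- by right; exists i.+1; split=> //; apply: small.
- by lia.
- by left.
Qed.
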